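(* Fix a positive integer $k$ and a real $\epsilon>0$. Given the data $(A,b,d)$ of a $k$-dimensional (packing) knapsack instance, there is a polynomial-sized extended LP relaxation $L$ of the feasible region $\{x\in\mathbb{Z}^n \mid 0\le x\le d, Ax\le b\}$, whose constraints do not depend on the value vector $c$, such that for the integer program $P=\{\max cx \mid x\in\mathbb{Z}^n, 0\le x\le d, Ax\le b\}$ one has $\mathrm{OPT}(P)\ge(1-\epsilon)\,\mathrm{OPT}(L)$, where $L$ is given the objective $\max cx$.
   Context: A $k$-dimensional knapsack instance is given by a nonnegative integral $k\times n$ matrix $A$, a nonnegative integral vector $b\in\mathbb{Z}^k$, a vector $d$ of length $n$ whose entries are nonnegative integers or $+\infty$, and a nonnegative vector $c\in\mathbb{R}^n$ of item values; the problem is $P=\{\max cx \mid x\in\mathbb{Z}^n, 0\le x\le d, Ax\le b\}$. An extended LP relaxation $L$ of $P$ is a linear program whose variables are the $n$ variables $x$ of $P$ together with additional variables, such that the projection of the feasible region of $L$ onto the $x$-variables contains exactly the same integral points as the feasible region of $P$, and whose objective function is $cx$ (ignoring the additional variables). ''Polynomial-sized'' means the number of variables and constraints of $L$ is bounded by a polynomial in the input size (for fixed $k$ and $\epsilon$). *)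

(* Defs.v *)
From mathcomp Require Import all_boot all_order all_algebra.
From mathcomp Require Import boolp classical_sets reals constructive_ereal ereal.

Set Implicit Arguments.
Unset Strict Implicit.
Unset Printing Implicit Defensive.

Import Order.TTheory GRing.Theory Num.Theory.
Local Open Scope classical_set_scope.
Local Open Scope ring_scope.

(* In [ks_d], [None] stands for an upper bound +oo. *)
Record knapsack (k n : nat) := Knapsack {
  ks_A : 'M[nat]_(k, n);
  ks_b : 'cV[nat]_k;
  ks_d : 'I_n -> option nat
}.

Definition below_bound (z : int) (u : option nat) : Prop :=
  if u is Some v then z <= v%:Z else True.

Definition ks_feasible (k n : nat) (K : knapsack k n) (x : 'cV[int]_n) : Prop :=
  (forall j, 0 <= x j 0 /\ below_bound (x j 0) (ks_d K j)) /\
  (forall i, (map_mx Posz (ks_A K) *m x) i 0 <= (ks_b K i 0)%:Z).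

(* Length of the binary expansion; 0 is written with one digit. *)
Definition bitlen (a : nat) : nat := (trunc_log 2 a).+1.

Definition bound_bitlen (u : option nat) : nat :=
  if u is Some v then bitlen v else 1%N.

Definition input_size (k n : nat) (K : knapsack k n) : nat :=
  (\sum_(i < k) \sum_(j < n) bitlen (ks_A K i j)
   + \sum_(i < k) bitlen (ks_b K i 0%R)
   + \sum_(j < n) bound_bitlen (ks_d K j))%N.

(* The system  M x + N y <= h  in the n variables x and [elp_extra] additional
   variables y; all variables are free, so sign constraints and equations are
   rows of the system and are counted in [elp_rows]. *)
Record ext_lp (R : realType) (n : nat) := ExtLP {
  elp_extra : nat;
  elp_rows : nat;
  elp_M : 'M[R]_(elp_rows, n);
  elp_N : 'M[R]_(elp_rows, elp_extra);
  elp_h : 'cV[R]_elp_rows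
}.

Definition elp_feasible (R : realType) (n : nat) (L : ext_lp R n)
    (x : 'cV[R]_n) (y : 'cV[R]_(elp_extra L)) : Prop :=
  forall i, (elp_M L *m x + elp_N L *m y) i 0 <= elp_h L i 0.

Definition elp_proj (R : realType) (n : nat) (L : ext_lp R n) : set 'cV[R]_n :=
  [set x | exists y, @elp_feasible R n L x y].

Definition int_vec (R : realType) (n : nat) (x : 'cV[int]_n) : 'cV[R]_n :=
  map_mx intr x.

Definition extended_relaxation (R : realType) (k n : nat)
    (K : knapsack k n) (L : ext_lp R n) : Prop :=
  forall x : 'cV[int]_n, elp_proj L (int_vec R x) <-> ks_feasible K x.

(* Optimal values are suprema in the extended reals: they are +oo for an
   unbounded problem. *)
Definition ks_opt (R : realType) (k n : nat) (K : knapsack k n)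
    (c : 'rV[R]_n) : \bar R :=
  ereal_sup [set ((c *m int_vec R x) 0 0)%:E | x in ks_feasible K].

Definition elp_opt (R : realType) (n : nat) (L : ext_lp R n)
    (c : 'rV[R]_n) : \bar R :=
  ereal_sup [set ((c *m x) 0 0)%:E | x in elp_proj L].

(* Main.v *)
(* A packing is split into the k items that are largest in row i, chosen once
   for every row i and every one of T groups, and a remainder whose items are,
   in each row, no larger than the chosen ones.  The relaxation is the
   disjunction, over all choices, of the linear relaxation of the remainder
   problem.  A remainder can be assumed to have at most k fractional
   coordinates; rounding all of them up is feasible once one group has been
   removed, since in each row the removed group contains k items at least as
   large as those rounded up.  The groups are disjoint, so on average over
   them only a fraction 1/T of the value is lost, whatever the value vector. *)
Require Import Defs.
From mathcomp Require Import all_boot all_order all_algebra.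
From mathcomp Require Import boolp classical_sets reals constructive_ereal ereal.
From mathcomp Require Import zify lra.

Set Implicit Arguments.
Unset Strict Implicit.
Unset Printing Implicit Defensive.

Import Order.TTheory GRing.Theory Num.Theory.
Local Open Scope ring_scope.

(** * Rounding a fractional point to one with few fractional coordinates *)

(** The columns of [A] indexed by [S] are more than [k] vectors in a space of dimension [k], hence
    linearly dependent; [r] is a dependency padded with zeros. *)
Lemma kernel_supported (F : fieldType) (k n : nat) (A : 'M[F]_(k, n))
    (S : {set 'I_n}) :
  (k < #|S|)%N ->
  exists r : 'cV[F]_n, [/\ A *m r = 0, forall j, j \notin S -> r j 0 = 0 &
    exists j, r j 0 != 0].
Proof.
move=> ltkS; pose P : 'M[F]_(#|S|, n) := \matrix_(i, j) (enum_val i == j)%:R.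
have /rowV0Pn[u /sub_kermxP uK u0] : kermx (P *m A^T) != 0.
  rewrite kermx_eq0 -row_leq_rank -ltnNge.
  exact: leq_ltn_trans (rank_leq_col _) ltkS.
have uP j : (u *m P) 0 j = \sum_(i | enum_val i == j) u 0 i.
  rewrite mxE [RHS]big_mkcond; apply: eq_bigr => i _; rewrite mxE.
  by case: eqP => _; rewrite ?mulr1 ?mulr0.
exists (u *m P)^T; split.
- by rewrite -[A]trmxK -trmx_mul -mulmxA uK trmx0.
- move=> j jS; rewrite mxE uP big1 // => i /eqP eij.
  by rewrite -eij enum_valP in jS.
- have /existsP[i ui] : [exists i, u 0 i != 0].
    apply: contraNT u0 => /existsPn u0; apply/eqP/rowP => i.
    by rewrite mxE; apply/eqP; move: (u0 i); rewrite negbK.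
  exists (enum_val i); rewrite mxE uP (big_pred1 i) // => i' /=.
  by rewrite (inj_eq enum_val_inj).
Qed.

(* Move along [r] until the first coordinate hits an integer. *)
Lemma step_to_integer (R : realType) (n : nat) (y r : 'cV[R]_n) :
  (exists j, r j 0 != 0) ->
  (forall j, r j 0 != 0 -> y j 0 \isn't a Num.int) ->
  exists2 t : R, 0 <= t &
    (forall j (m : int),
       (y j 0 <= m%:~R -> (y + t *: r) j 0 <= m%:~R) /\
       (m%:~R <= y j 0 -> m%:~R <= (y + t *: r) j 0)) /\
    exists2 j, y j 0 \isn't a Num.int & (y + t *: r) j 0 \is a Num.int.
Proof.
move=> [j0 rj0] yfrac.
(* [tgt j] is the first integer coordinate [j] meets when moving along [r], and [tau j] the time it
   gets there; the step taken is the smallest such time. *)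
pose tgt j : int := if 0 < r j 0 then Num.floor (y j 0) + 1 else Num.floor (y j 0).
pose tau j : R := ((tgt j)%:~R - y j 0) / r j 0.
have flt j : r j 0 != 0 -> (Num.floor (y j 0))%:~R < y j 0 < (Num.floor (y j 0))%:~R + 1.
  move=> /yfrac; have /andP[le1 lt2] := floor_itv (y j 0).
  rewrite intrEfloor => ne; rewrite lt_neqAle ne le1 /=.
  by move: lt2; rewrite intrD.
have tau_gt0 j : r j 0 != 0 -> 0 <= tau j.
  move=> rj; have /andP[l1 l2] := flt j rj; rewrite /tau /tgt.
  case: ltP => [r0|r0].
    by rewrite divr_ge0 ?ltW // intrD; lra.
  by rewrite mulr_le0 // ?invr_le0 // subr_le0 ltW.
case: (@arg_minP _ _ _ j0 (fun j => r j 0 != 0) tau rj0) => j rj jmin.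
exists (tau j); first exact: tau_gt0.
split; last first.
  exists j; first exact: yfrac.
  by rewrite !mxE /tau mulfVK // addrC subrK.
move=> i m; rewrite !mxE.
have [->|ri] := eqVneq (r i 0) 0; first by rewrite mulr0 addr0.
have /andP[l1 l2] := flt i ri.
have t0 := tau_gt0 _ rj; have := jmin i ri; rewrite {2}/tau /tgt.
(* An integer bound on [y i 0] already holds for the endpoint of the unit interval around it, and
   the step does not leave that interval. *)
have hm : m%:~R <= y i 0 -> m%:~R <= (Num.floor (y i 0))%:~R :> R.
  by rewrite ler_int floor_ge_int.
have hM : y i 0 <= m%:~R -> (Num.floor (y i 0))%:~R + 1 <= m%:~R :> R.
  move=> yM; rewrite -[1]/(1%:~R) -intrD ler_int.
  by rewrite lezD1 -(ltr_int R); apply: lt_le_trans yM.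
case: ltP => r0.
  rewrite ler_pdivlMr // intrD => le.
  have ? : 0 <= tau j * r i 0 by rewrite mulr_ge0 // ltW.
  by split => [/hM|/hm] ?; lra.
have rn : r i 0 < 0 by rewrite lt_neqAle ri.
rewrite ler_ndivlMr // => le.
have ? : tau j * r i 0 <= 0 by rewrite mulr_ge0_le0.
by split => [/hM|/hm] ?; lra.
Qed.

(** As long as more than [k] coordinates are fractional, some kernel direction of [A] is supported
    on them; with the right sign it does not decrease [c], and moving along it makes one more
    coordinate integral without crossing an integer. *)
Lemma few_fractional (R : realType) (k n : nat) (A : 'M[R]_(k, n))
    (c : 'rV[R]_n) (y : 'cV[R]_n) :
  exists w : 'cV[R]_n, [/\ A *m w = A *m y,
    (c *m y) 0 0 <= (c *m w) 0 0,
    forall j (m : int), (y j 0 <= m%:~R -> w j 0 <= m%:~R) /\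
                        (m%:~R <= y j 0 -> m%:~R <= w j 0) &
    (#|[set j | w j 0%R \isn't a Num.int]| <= k)%N].
Proof.
have [N] := ubnP #|[set j | y j 0 \isn't a Num.int]|.
elim: N y => // N IH y; rewrite ltnS => leN.
set S := [set j | _] in leN.
have [leSk|/(kernel_supported A)[r [Ar rS rn0]]] := leqP #|S| k.
  by exists y; split.
wlog cr : r Ar rS rn0 / 0 <= (c *m r) 0 0.
  move=> H; have [|c0] := leP 0 ((c *m r) 0 0); first exact: (H r).
  apply: (H (- r)); rewrite ?mulmxN ?Ar ?oppr0 //.
  - by move=> j /rS; rewrite mxE => ->; rewrite oppr0.
  - by case: rn0 => j rj; exists j; rewrite mxE oppr_eq0.
  - by rewrite mxE oppr_ge0 ltW.
have yfrac j : r j 0 != 0 -> y j 0 \isn't a Num.int.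
  by apply: contraNN => yj; apply/eqP/rS; rewrite inE negbK.
have [t t0 [bnd [j yj wj]]] := step_to_integer rn0 yfrac.
have [|w [Aw cw wb wk]] := IH (y + t *: r).
  apply: leq_trans leN; apply: proper_card; apply/properP; split.
    (* An integral coordinate has itself as lower and upper integer bound, so it does not move. *)
    apply/fintype.subsetP => i; rewrite !inE; apply: contraNN => /intrP[m ym].
    have [b1 b2] := bnd i m; apply/intrP; exists m; apply/eqP.
    by rewrite eq_le b1 ?ym // b2 ?ym.
  by exists j; rewrite !inE ?yj // wj.
exists w; split => //.
- by rewrite Aw mulmxDr -scalemxAr Ar scaler0 addr0.
- apply: le_trans cw; rewrite mulmxDr -scalemxAr [X in _ <= X]mxE lerDl mxE.
  exact: mulr_ge0.
- by move=> i m; have [b1 b2] := bnd i m; have [b3 b4] := wb i m; split; auto.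
Qed.

(** * Guesses, their cones, and rounding inside a cone *)

(* A guess [s] selects, for every group [t] and every row [i], [k] items
   [s (t, (i, l))]; the value [None] means that the items have run out. *)
Notation guess k T n := {ffun 'I_T * ('I_k * 'I_k) -> option 'I_n}.

Definition guess_count (k T n : nat) (s : guess k T n) (j : 'I_n) : nat :=
  (\sum_e (s e == Some j))%N.

Definition group_count (k T n : nat) (s : guess k T n) (t : 'I_T) (j : 'I_n) : nat :=
  (\sum_f (s (t, f) == Some j))%N.

(** [e.2.1] is the row for which slot [e] is chosen. An empty slot makes every item ineligible: once
    the items have run out, the remainder is empty. *)
Definition eligible (k T n : nat) (K : knapsack k n) (s : guess k T n)
    (j : 'I_n) : bool :=
  [forall e, if s e is Some j' then (ks_A K e.2.1 j <= ks_A K e.2.1 j')%N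
             else false].

(* The homogenization, with multiplier [lam], of the polyhedron of fractional
   packings that contain the items of [s] and otherwise only eligible ones. *)
Definition guess_cone (R : realType) (k T n : nat) (K : knapsack k n)
    (s : guess k T n) (lam : R) (z : 'cV[R]_n) : Prop :=
  [/\ 0 <= lam,
      forall j, lam * (guess_count s j)%:R <= z j 0,
      forall j, if ks_d K j is Some u then z j 0 <= lam * u%:R else true,
      forall j, ~~ eligible K s j -> z j 0 <= lam * (guess_count s j)%:R &
      forall i, \sum_j (ks_A K i j)%:R * z j 0 <= lam * (ks_b K i 0)%:R].

Lemma sum_group_count (k T n : nat) (s : guess k T n) (j : 'I_n) :
  (\sum_t group_count s t j = guess_count s j)%N.
Proof.
by rewrite pair_bigA; apply: eq_bigr => -[].
Qed.

Lemma group_count_le (k T n : nat) (s : guess k T n) (t : 'I_T) (j : 'I_n) :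
  (group_count s t j <= guess_count s j)%N.
Proof. by rewrite -sum_group_count (bigD1 t) //= leq_addr. Qed.

(* The [k] items of group [t] chosen for row [i] pay for rounding up at most
   [k] eligible items in that row. *)
Lemma group_weight_ge (k T n : nat) (K : knapsack k n) (s : guess k T n)
    (t : 'I_T) (i : 'I_k) (F : {set 'I_n}) :
  (#|F| <= k)%N -> (forall j, j \in F -> eligible K s j) ->
  (\sum_(j in F) ks_A K i j <= \sum_j ks_A K i j * group_count s t j)%N.
Proof.
move=> leFk elF; have [->|[j0 j0F]] := set_0Vmem F; first by rewrite big_set0.
(* [F] weighs at most [k] times its heaviest item [m]; as [m] is eligible, each of the [k] slots of
   group [t] and row [i] holds an item at least as heavy. *)
case: (@arg_maxnP _ j0 (mem F) (fun j => ks_A K i j) j0F) => m mF mmax.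
have /forallP elm := elF m mF.
apply: (@leq_trans (k * ks_A K i m)).
  apply: (@leq_trans (\sum_(j in F) ks_A K i m)).
    by apply: leq_sum => j /mmax.
  by rewrite sum_nat_const leq_mul2r leFk orbT.
have -> : (\sum_j ks_A K i j * group_count s t j =
  \sum_i' \sum_l \sum_j ks_A K i j * (s (t, (i', l)) == Some j))%N.
  rewrite pair_bigA exchange_big; apply: eq_bigr => j _.
  by rewrite big_distrr; apply: eq_bigr => -[].
rewrite (bigD1 i) //=; apply: leq_trans (leq_addr _ _).
rewrite -[k in (k * _)%N](card_ord k) -sum_nat_const; apply: leq_sum => l _.
have := elm (t, (i, l)); case: (s _) => // j' /= le.
by rewrite (bigD1 j') //= eqxx muln1 (leq_trans le) // leq_addr.
Qed.

Lemma ks_feasibleR (R : realType) (k n : nat) (K : knapsack k n) (x : 'cV[int]_n) :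
  (forall i, \sum_j (ks_A K i j)%:R * (x j 0)%:~R <= (ks_b K i 0)%:R :> R) <->
  (forall i, (map_mx Posz (ks_A K) *m x) i 0 <= (ks_b K i 0)%:Z).
Proof.
have E i : ((map_mx Posz (ks_A K) *m x) i 0)%:~R =
    \sum_j (ks_A K i j)%:R * (x j 0)%:~R :> R.
  rewrite mxE rmorph_sum; apply: eq_bigr => j _.
  by rewrite mxE rmorphM /=.
by split => H i; have := H i; rewrite -E -(ler_int R).
Qed.

(** For each [t], dropping group [t] and rounding the remainder up gives a packing [x t]. Summing
    the values of these [T] packings gives the bound. *)
Lemma guess_rounding (R : realType) (k T n : nat) (K : knapsack k n)
    (s : guess k T n) (z : 'cV[R]_n) (c : 'rV[R]_n) (v : R) :
  guess_cone K s 1 z -> (forall j, 0 <= c 0 j) ->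
  (forall x, ks_feasible K x -> (c *m int_vec R x) 0 0 <= v) ->
  (T%:R - 1) * (c *m z) 0 0 <= T%:R * v.
Proof.
move=> [_ lb ub inel cap] c0 vP.
pose S : 'cV[R]_n := \col_j (guess_count s j)%:R.
pose y := z - S.
pose A : 'M[R]_(k, n) := \matrix_(i, j) (ks_A K i j)%:R.
have [w [Aw cw wb wk]] := few_fractional A c y.
have yE j : y j 0 = z j 0 - (guess_count s j)%:R by rewrite !mxE.
have y0 j : 0 <= y j 0 by rewrite yE subr_ge0; have := lb j; rewrite mul1r.
have w0 j : 0 <= w j 0 by have [_] := wb j 0; apply; exact: y0.
(* An ineligible item has no remainder, so [w] is 0 there: only eligible items get rounded up. *)
have elF j : j \in [set j | w j 0 \isn't a Num.int] -> eligible K s j.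
  rewrite inE; apply: contraR => /inel; rewrite mul1r => zj.
  suff -> : w j 0 = 0%:~R by apply: intr_int.
  apply/eqP; rewrite eq_le w0 andbT; have [h _] := wb j 0.
  by apply: h; rewrite yE subr_le0.
pose x t : 'cV[int]_n :=
  \col_j ((guess_count s j)%:Z - (group_count s t j)%:Z + Num.ceil (w j 0)).
have xE t j : (x t j 0)%:~R = (guess_count s j)%:R - (group_count s t j)%:R
    + (Num.ceil (w j 0))%:~R :> R.
  by rewrite mxE !intrD intrN.
have cE j : (Num.ceil (w j 0))%:~R <= w j 0 + (w j 0 \isn't a Num.int)%:R :> R.
  rewrite ceil_floor intrD lerD //.
  by have /andP[] := floor_itv (w j 0).
have xfeas t : ks_feasible K (x t).
  split; last first.
    apply/(ks_feasibleR R) => i.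
    apply: (@le_trans _ _ (\sum_j (ks_A K i j)%:R * z j 0)); last first.
      by have := cap i; rewrite mul1r.
    have Awi : \sum_j (ks_A K i j)%:R * w j 0 = \sum_j (ks_A K i j)%:R * y j 0.
      have := congr1 (fun B : 'cV_k => B i 0) Aw; rewrite !mxE.
      by under eq_bigr do rewrite mxE; under [in RHS]eq_bigr do rewrite mxE.
    have := group_weight_ge t i wk elF; rewrite -(ler_nat R) !natr_sum big_mkcond /=.
    under [X in _ <= X]eq_bigr do rewrite natrM.
    move=> gw.
    rewrite -subr_ge0.
    (* The inserted difference vanishes by [Awi]; with it the inequality can be checked item by
       item. *)
    apply: (@le_trans _ _ (\sum_j (ks_A K i j)%:R * (group_count s t j)%:R -
       \sum_j (if j \in [set j | w j 0 \isn't a Num.int] then (ks_A K i j)%:R else 0)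
       + (\sum_j (ks_A K i j)%:R * y j 0 - \sum_j (ks_A K i j)%:R * w j 0))).
      by rewrite Awi subrr addr0 subr_ge0.
    rewrite -!sumrB -big_split /=; apply: ler_sum => j _.
    rewrite xE yE inE.
    have := cE j; have : 0 <= (ks_A K i j)%:R :> R by [].
    by case: (w j 0 \isn't a Num.int) => /=; rewrite ?mulr1n ?mulr0n => h1 h2; nra.
  move=> j; split.
    rewrite mxE addr_ge0 //; first by rewrite subr_ge0 lez_nat group_count_le.
    by rewrite ceil_ge0; apply: lt_le_trans (w0 j); lra.
  have := ub j; case: (ks_d K j) => //= u; rewrite mul1r => zu.
  rewrite mxE -lerBrDl.
  (* The residual bound is an integer, so it passes from [y] to [w] and then to the ceiling of
     [w]. *)
  apply: (@le_trans _ _ (u%:Z - (guess_count s j)%:Z)).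
    rewrite ceil_le_int; have [h _] := wb j (u%:Z - (guess_count s j)%:Z).
    by apply: h; rewrite intrD intrN yE lerB.
  by rewrite lerD2l lerN2; lia.
have : \sum_t (c *m int_vec R (x t)) 0 0 <= T%:R * v.
  apply: (@le_trans _ _ (\sum_(t < T) v)); first by apply: ler_sum => t _; apply: vP.
  by rewrite sumr_const card_ord mulr_natl.
apply: le_trans.
have cz : (c *m z) 0 0 = (c *m S) 0 0 + (c *m y) 0 0.
  by rewrite -[in LHS](subrK S z) mulmxDr mxE addrC.
have cS0 : 0 <= (c *m S) 0 0.
  by rewrite mxE; apply: sumr_ge0 => j _; rewrite mulr_ge0 // mxE.
have cy0 : 0 <= (c *m y) 0 0.
  by rewrite mxE; apply: sumr_ge0 => j _; rewrite mulr_ge0.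
have T0 : 0 <= T%:R :> R by [].
apply: (@le_trans _ _ ((T%:R - 1) * (c *m S) 0 0 + T%:R * (c *m w) 0 0)).
  by rewrite cz; nra.
rewrite [(c *m S) 0 0]mxE [(c *m w) 0 0]mxE.
under [X in _ <= X]eq_bigr do rewrite mxE.
rewrite exchange_big /= !mulr_sumr -big_split; apply: ler_sum => j _ /=.
rewrite -mulr_sumr mxE.
(* Over the [T] packings each guessed copy is dropped exactly once. *)
have -> : \sum_(t < T) (int_vec R (x t)) j 0 =
   T%:R * (guess_count s j)%:R - (guess_count s j)%:R + T%:R * (Num.ceil (w j 0))%:~R.
  under eq_bigr do rewrite mxE xE.
  rewrite big_split sumrB /= !sumr_const card_ord -natr_sum sum_group_count.
  by rewrite !mulr_natl.
have := ceil_ge (w j 0); have := c0 j; move=> h1 h2.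
have : T%:R * (c 0 j * w j 0) <= T%:R * (c 0 j * (Num.ceil (w j 0))%:~R).
  by rewrite ler_wpM2l // ler_wpM2l.
lra.
Qed.

Lemma guess_cone_scale (R : realType) (k T n : nat) (K : knapsack k n)
    (s : guess k T n) (lam mu : R) (z : 'cV[R]_n) :
  0 <= mu -> guess_cone K s lam z -> guess_cone K s (mu * lam) (mu *: z).
Proof.
move=> mu0 [l0 lb ub inel cap]; split.
- exact: mulr_ge0.
- by move=> j; rewrite mxE -mulrA ler_wpM2l.
- move=> j; have := ub j; case: (ks_d K j) => // u zu.
  by rewrite mxE -mulrA ler_wpM2l.
- by move=> j /inel zj; rewrite mxE -mulrA ler_wpM2l.
- move=> i; rewrite -mulrA; under eq_bigr do rewrite mxE mulrCA.
  by rewrite -mulr_sumr ler_wpM2l.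
Qed.

(** Such an item can be packed any number of times, so a positive value would push the packings
    beyond [v]. *)
Lemma free_item_value0 (R : realType) (k n : nat) (K : knapsack k n)
    (c : 'rV[R]_n) (v : R) (j : 'I_n) :
  (forall x, ks_feasible K x -> (c *m int_vec R x) 0 0 <= v) ->
  ks_d K j = None -> (forall i, ks_A K i j = 0%N) -> c 0 j <= 0.
Proof.
move=> vP dj Aj; rewrite leNgt; apply/negP => cj.
pose x (N : nat) : 'cV[int]_n := \col_i (if i == j then N%:Z else 0).
have xf N : ks_feasible K (x N).
  split=> [i|i].
    by rewrite mxE; case: eqP => [->|_]; rewrite ?dj //; case: (ks_d K i).
  rewrite mxE big1 // => l _; rewrite !mxE.
  by case: eqP => [->|_]; rewrite ?Aj ?mul0r ?mulr0.
have cx N : (c *m int_vec R (x N)) 0 0 = c 0 j * N%:R.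
  rewrite mxE (bigD1 j) //= big1 ?addr0.
    by rewrite !mxE eqxx.
  by move=> i /negPf ij; rewrite !mxE ij mulr0.
have v0 : 0 <= v by have := vP _ (xf 0%N); rewrite cx mulr0.
have := vP _ (xf (Num.bound (v / c 0 j))); rewrite cx leNgt.
rewrite mulrC -ltr_pdivrMr //; apply/negP/negPn/archi_boundP.
by rewrite divr_ge0 // ltW.
Qed.

(** A positive multiplier is scaled to 1. For multiplier 0, [z] is a recession direction: it uses
    only unbounded items of weight 0, which are worthless since [v] is finite. *)
Lemma guess_cone_value (R : realType) (k T n : nat) (K : knapsack k n)
    (s : guess k T n) (lam : R) (z : 'cV[R]_n) (c : 'rV[R]_n) (v : R) :
  guess_cone K s lam z -> (forall j, 0 <= c 0 j) ->
  (forall x, ks_feasible K x -> (c *m int_vec R x) 0 0 <= v) ->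
  (T%:R - 1) * (c *m z) 0 0 <= T%:R * (lam * v).
Proof.
move=> zC c0 vP; have [l0 lb ub _ cap] := zC.
have [lam0|lamN0] := eqVneq lam 0; last first.
  have lgt : 0 < lam by rewrite lt_neqAle eq_sym lamN0.
  have li0 : 0 <= lam^-1 by rewrite invr_ge0.
  have := guess_cone_scale li0 zC; rewrite mulVf // => /guess_rounding/(_ c0 vP).
  rewrite -scalemxAr mxE mulrCA -ler_pdivlMl ?invr_gt0 // invrK.
  by rewrite mulrCA.
have z0 j : 0 <= z j 0 by have := lb j; rewrite lam0 mul0r.
have -> : (c *m z) 0 0 = 0; last by rewrite lam0 mul0r !mulr0.
rewrite mxE big1 // => j _; apply/eqP; rewrite mulf_eq0.
have [//|zj] := eqVneq (z j 0) 0; first by rewrite orbT.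
have zgt : 0 < z j 0 by rewrite lt_neqAle eq_sym zj z0.
rewrite orbF eq_le c0 andbT; apply: (free_item_value0 vP).
  have := ub j; case: (ks_d K j) => // u; rewrite lam0 mul0r => zle.
  by have := lt_le_trans zgt zle; rewrite ltxx.
move=> i; have := cap i; rewrite lam0 mul0r (bigD1 j) //= => le0.
have : (ks_A K i j)%:R * z j 0 <= 0.
  apply: le_trans le0; rewrite lerDl; apply: sumr_ge0 => l _.
  exact: mulr_ge0.
by rewrite pmulr_lle0 // -[0]/(0%:R) ler_nat leqn0 => /eqP.
Qed.

(** * Every packing arises from a guess, and the cones add up to packings only *)

(** Each slot in turn takes a remaining item that is largest in its own measure [a e]. The remainder
    only shrinks later, so the comparison persists. *)
Lemma greedy_choice (E : eqType) (n : nat) (a : E -> 'I_n -> nat) (q : seq E)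
    (x : 'I_n -> nat) :
  uniq q ->
  exists s : E -> option 'I_n, exists y : 'I_n -> nat,
    (forall j, x j = (\sum_(e <- q) (s e == Some j) + y j)%N) /\
    (forall j, (0 < y j)%N -> forall e, e \in q ->
       if s e is Some j' then (a e j <= a e j')%N else false).
Proof.
elim: q x => [|e q IH] x /=.
  by move=> _; exists (fun=> None), x; split=> // j; rewrite big_nil.
move=> /andP[eq uq].
have [/existsP[j0 xj0]|/existsPn x0] := boolP [exists j, (0 < x j)%N]; last first.
  exists (fun=> None), (fun=> 0%N); split=> // j.
  by rewrite big1 //; apply/eqP; rewrite -leqn0 leqNgt.
case: (@arg_maxnP _ j0 (fun j => 0 < x j)%N (a e) xj0) => m xm mmax.
have [s [y [xE yP]]] := IH (fun j => x j - (m == j))%N uq.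
have yx j : (y j <= x j)%N.
  by apply: leq_trans (leq_subr (m == j) _); rewrite xE leq_addl.
exists (fun e' => if e' == e then Some m else s e'), y; split=> [j|j yj e'].
  rewrite big_cons eqxx (_ : \sum_(i <- q) _ = \sum_(i <- q) (s i == Some j))%N.
    rewrite -addnA -xE (inj_eq Some_inj) subnKC //.
    by case: eqP => [<-|].
  rewrite !big_seq; apply: eq_bigr => i iq; case: (i =P e) => // ie.
  by rewrite -ie iq in eq.
rewrite inE; case: eqP => [-> _|_] /=; last exact: yP.
by apply: mmax; apply: leq_trans (yx j).
Qed.

Lemma feasible_guess (R : realType) (k T n : nat) (K : knapsack k n)
    (x : 'cV[int]_n) :
  ks_feasible K x -> exists s : guess k T n, guess_cone K s 1 (int_vec R x).
Proof.
move=> [xb xc].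
have [s [y [xE yP]]] := @greedy_choice _ n (fun (e : 'I_T * ('I_k * 'I_k)) j => ks_A K e.2.1 j)
  (enum predT) (fun j => absz (x j 0)) (enum_uniq _).
have xR j : (x j 0)%:~R = (absz (x j 0))%:R :> R.
  by have [x0 _] := xb j; rewrite -[in LHS](gez0_abs x0).
have cE j : guess_count (finfun s) j = (\sum_(e <- enum predT) (s e == Some j))%N.
  by rewrite /guess_count big_enum; apply: eq_bigr => e _; rewrite ffunE.
exists (finfun s); split=> //.
- by move=> j; rewrite mul1r mxE xR ler_nat xE cE leq_addr.
- move=> j; have [_] := xb j.
  by case: (ks_d K j) => //= u; rewrite mul1r mxE -(ler_int R).
(* An ineligible item is absent from the greedy remainder, so all its copies are guessed. *)
- move=> j el; rewrite mul1r mxE xR ler_nat xE cE.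
  case: posnP (yP j) => [->|yj /(_ isT) H]; first by rewrite addn0.
  case/negP: el; apply/forallP => e; rewrite ffunE; apply: H.
  by rewrite mem_enum.
- move=> i; rewrite mul1r; move/(ks_feasibleR R): xc => /(_ i).
  by apply: le_trans; apply: ler_sum => j _; rewrite mxE.
Qed.

(** The homogenized bounds and capacities are summed over the guesses; their right-hand sides are
    nonnegative, so total multiplier at most 1 suffices. *)
Lemma guess_cone_sum_feasible (R : realType) (k T n : nat) (K : knapsack k n)
    (lam : guess k T n -> R) (z : guess k T n -> 'cV[R]_n) (x : 'cV[int]_n) :
  (forall s, guess_cone K s (lam s) (z s)) -> \sum_s lam s <= 1 ->
  int_vec R x = \sum_s z s -> ks_feasible K x.
Proof.
move=> zC lam1 xz.
have xE j : (x j 0)%:~R = \sum_s z s j 0 :> R.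
  by have := congr1 (fun B : 'cV_n => B j 0) xz; rewrite summxE mxE.
have lamU (u : nat) : \sum_s lam s * u%:R <= u%:R :> R.
  by rewrite -mulr_suml ler_piMl.
split=> [j|].
  split.
    rewrite -(ler_int R) xE; apply: sumr_ge0 => s _.
    by have [l0 lb _ _ _] := zC s; apply: le_trans (lb j); rewrite mulr_ge0.
  rewrite /below_bound; case dj: (ks_d K j) => [u|] //.
  rewrite -(ler_int R) xE; apply: le_trans (lamU u); apply: ler_sum => s _.
  by have [_ _ ub _ _] := zC s; have := ub j; rewrite dj.
apply/(ks_feasibleR R) => i; apply: le_trans (lamU _).
under eq_bigr do rewrite xE mulr_sumr.
by rewrite exchange_big; apply: ler_sum => s _; have [_ _ _ _ cap] := zC s.
Qed.

(** * The disjunctive program as an explicit linear system *)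

(** Finite types as index sets let rows and variables carry structured names, and their number
    follows from cardinality rules. *)
Definition fin_lp (R : realType) (n : nat) (V I : finType) (M : I -> 'I_n -> R)
    (N : I -> V -> R) (h : I -> R) : ext_lp R n :=
  ExtLP (\matrix_(i < #|I|, j < n) M (enum_val i) j)
        (\matrix_(i < #|I|, v < #|V|) N (enum_val i) (enum_val v))
        (\col_(i < #|I|) h (enum_val i)).

Lemma fin_lpP (R : realType) (n : nat) (V I : finType) (M : I -> 'I_n -> R)
    (N : I -> V -> R) (h : I -> R) (x : 'cV[R]_n) :
  elp_proj (fin_lp M N h) x <->
  exists y : V -> R, forall i, \sum_j M i j * x j 0 + \sum_v N i v * y v <= h i.
Proof.
split=> [[y yP]|[y yP]].
  exists (fun v => y (enum_rank v) 0) => i; have := yP (enum_rank i).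
  rewrite !mxE enum_rankK; apply: le_trans; rewrite lerD //.
    by apply: ler_sum => j _; rewrite mxE enum_rankK.
  rewrite (reindex (@enum_val V predT)) /=; last exact/onW_bij/enum_val_bij.
  by apply: ler_sum => j _; rewrite mxE enum_rankK enum_valK.
exists (\col_v y (enum_val v)) => i; rewrite !mxE.
have := yP (enum_val i); apply: le_trans; rewrite lerD //.
  by apply: ler_sum => j _; rewrite mxE.
rewrite [X in _ <= X](reindex (@enum_val V predT)) /=; last first.
  exact/onW_bij/enum_val_bij.
by apply: ler_sum => j _; rewrite !mxE.
Qed.

Lemma sum_delta (R : pzRingType) (I : finType) (j : I) (f : I -> R) :
  \sum_l (l == j)%:R * f l = f j.
Proof.
rewrite (bigD1 j) //= eqxx mul1r big1 ?addr0 // => l /negPf ->.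
by rewrite mul0r.
Qed.

(** In order: lower bounds from the guess, bounds [ks_d], bounds on ineligible items, capacities,
    sign of the multiplier. A bound that does not apply becomes [0 <= 0], so all guesses share one
    row type. *)
Notation cone_row n k := ('I_n + 'I_n + 'I_n + 'I_k + unit)%type.

(* The coefficients of the multiplier and of the point in the rows
   [_ <= 0] describing [guess_cone K s]. *)
Definition cone_coef (R : realType) (k T n : nat) (K : knapsack k n)
    (s : guess k T n) (r : cone_row n k) : R * ('I_n -> R) :=
  match r with
  | inl (inl (inl (inl j))) => ((guess_count s j)%:R, fun l => - (l == j)%:R)
  | inl (inl (inl (inr j))) =>
      if ks_d K j is Some u then (- u%:R, fun l => (l == j)%:R)
      else (0, fun=> 0)
  | inl (inl (inr j)) =>
      if eligible K s j then (0, fun=> 0)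
      else (- (guess_count s j)%:R, fun l => (l == j)%:R)
  | inl (inr i) => (- (ks_b K i 0)%:R, fun l => (ks_A K i l)%:R)
  | inr _ => (-1, fun=> 0)
  end.

Lemma cone_coefP (R : realType) (k T n : nat) (K : knapsack k n)
    (s : guess k T n) (lam : R) (z : 'I_n -> R) :
  (forall r, (cone_coef R K s r).1 * lam + \sum_l (cone_coef R K s r).2 l * z l <= 0)
  <-> guess_cone K s lam (\col_l z l).
Proof.
have sum0 : \sum_l 0 * z l = 0 by rewrite big1 // => l _; rewrite mul0r.
have sumN j : \sum_l - (l == j)%:R * z l = - z j.
  by under eq_bigr do rewrite mulNr; rewrite sumrN sum_delta.
split=> [H|[l0 lb ub inel cap]].
  split.
  - by have := H (inr tt); rewrite /= sum0; lra.
  - move=> j; have := H (inl (inl (inl (inl j)))); rewrite /= sumN mxE; lra.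
  - move=> j; have := H (inl (inl (inl (inr j)))); rewrite /= mxE.
    by case: (ks_d K j) => //= u; rewrite sum_delta; lra.
  - move=> j /negPf el; have := H (inl (inl (inr j))); rewrite /= el /= sum_delta mxE; lra.
  - move=> i; have := H (inl (inr i)) => /=.
    under [X in _ -> X <= _]eq_bigr do rewrite mxE; lra.
move=> [[[[j|j]|j]|i]|[]] /=.
- by rewrite sumN; have := lb j; rewrite mxE; lra.
- have := ub j; case: (ks_d K j) => [u|] /=; rewrite ?sum_delta ?sum0 ?mxE; lra.
- have := inel j; case: (eligible K s j) => /= h; first by rewrite sum0; lra.
  by have := h isT; rewrite sum_delta mxE; lra.
- have := cap i; under [X in X <= _ -> _]eq_bigr do rewrite mxE; lra.
- by rewrite sum0; lra.
Qed.

(* Balas' disjunctive formulation of the convex hull of the union over all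
   guesses: [x] is a sum of points [z s] of the cones [guess_cone K s], with
   multipliers [lam s] of total at most 1; the extra variables are
   [lam s] ([inl s]) and [z s l] ([inr (s, l)]). *)
Definition knapsack_lp (R : realType) (k T n : nat) (K : knapsack k n) : ext_lp R n :=
  @fin_lp R n (guess k T n + guess k T n * 'I_n)%type
    (guess k T n * cone_row n k + ('I_n + 'I_n + unit))%type
    (fun i l => match i with
     | inr (inl (inl j)) => (l == j)%:R
     | inr (inl (inr j)) => - (l == j)%:R
     | _ => 0
     end)
    (fun i v => match i, v with
     | inl (s, r), inl s' => (s' == s)%:R * (cone_coef R K s r).1
     | inl (s, r), inr (s', l) => (s' == s)%:R * (cone_coef R K s r).2 l
     | inr (inl (inl j)), inr (_, l) => - (l == j)%:R
     | inr (inl (inr j)), inr (_, l) => (l == j)%:R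
     | inr (inr _), inl _ => 1
     | _, _ => 0
     end)
    (fun i => if i is inr (inr _) then 1 else 0).

Lemma knapsack_lpP (R : realType) (k T n : nat) (K : knapsack k n) (x : 'cV[R]_n) :
  elp_proj (knapsack_lp R T K) x <->
  exists lam : guess k T n -> R, exists z : guess k T n -> 'cV[R]_n,
    [/\ forall s, guess_cone K s (lam s) (z s), \sum_s lam s <= 1 & x = \sum_s z s].
Proof.
have sum0 (I : finType) (f : I -> R) : \sum_l 0 * f l = 0.
  by rewrite big1 // => l _; rewrite mul0r.
have sumN j (f : 'I_n -> R) : \sum_l - (l == j)%:R * f l = - f j.
  by under eq_bigr do rewrite mulNr; rewrite sumrN sum_delta.
have sumV (f : guess k T n -> R) (g : guess k T n -> 'I_n -> R)
    (y : guess k T n + guess k T n * 'I_n -> R) :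
    \sum_v match v with inl s => f s | inr (s, l) => g s l end * y v =
    \sum_s f s * y (inl s) + \sum_s \sum_l g s l * y (inr (s, l)).
  rewrite big_sumType pair_bigA; congr (_ + _).
  by apply: eq_bigr => -[].
have cone_sum s r (y : guess k T n + guess k T n * 'I_n -> R) :
    \sum_v match v with
      | inl s' => (s' == s)%:R * (cone_coef R K s r).1
      | inr (s', l) => (s' == s)%:R * (cone_coef R K s r).2 l end * y v =
    (cone_coef R K s r).1 * y (inl s) + \sum_l (cone_coef R K s r).2 l * y (inr (s, l)).
  rewrite sumV; congr (_ + _).
    by under eq_bigr do rewrite -mulrA; rewrite sum_delta.
  under eq_bigr => s' _.
    under eq_bigr do rewrite -mulrA.
    rewrite -mulr_sumr; over.
  by rewrite sum_delta.
rewrite fin_lpP; split=> [[y yP]|[lam [z [zC lam1 xE]]]].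
  exists (fun s => y (inl s)), (fun s => \col_l y (inr (s, l))); split.
  - move=> s; apply/cone_coefP => r; have := yP (inl (s, r)).
    by rewrite /= cone_sum sum0 add0r.
  - have := yP (inr (inr tt)); rewrite /= sum0 add0r big_sumType /= sum0 addr0.
    by under eq_bigr do rewrite mul1r.
  - apply/colP => j; rewrite summxE; under eq_bigr do rewrite mxE.
    apply/eqP; rewrite eq_le.
    have := yP (inr (inl (inl j))); have := yP (inr (inl (inr j))).
    rewrite /= !(sumV (fun=> 0)) !sum0 sum_delta sumN !add0r.
    rewrite (eq_bigr _ (fun s _ => sum_delta j (fun l => y (inr (s, l))))).
    rewrite (eq_bigr _ (fun s _ => sumN j (fun l => y (inr (s, l))))).
    by rewrite sumrN => h1 h2; apply/andP; split; lra.
exists (fun v => match v with inl s => lam s | inr (s, l) => z s l 0 end).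
have xj j : x j 0 = \sum_s z s j 0 by rewrite xE summxE.
move=> [[s r]|[[j|j]|[]]] /=.
- rewrite cone_sum sum0 add0r; move: r; apply/cone_coefP.
  suff -> : \col_l z s l 0 = z s by [].
  by apply/colP => l; rewrite mxE.
- rewrite (sumV (fun=> 0)) sum0 sum_delta add0r.
  by under eq_bigr do rewrite sumN; rewrite sumrN xj subrr.
- rewrite (sumV (fun=> 0)) sum0 sumN add0r.
  by under eq_bigr do rewrite sum_delta; rewrite xj addNr.
- rewrite sum0 add0r big_sumType /= sum0 addr0.
  by under eq_bigr do rewrite mul1r.
Qed.

(** * Validity, gap and size of the relaxation *)

Lemma knapsack_lp_relaxation (R : realType) (k T n : nat) (K : knapsack k n) :
  extended_relaxation K (knapsack_lp R T K).
Proof.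
move=> x; rewrite knapsack_lpP; split=> [[lam [z [zC lam1 xz]]]|xf].
  exact: guess_cone_sum_feasible zC lam1 xz.
have [s sP] := feasible_guess R T xf.
(* All the weight goes to one guess matching [x]; the other cones contribute their apex 0. *)
exists (fun s' => (s' == s)%:R), (fun s' => (s' == s)%:R *: int_vec R x); split.
- move=> s'; case: eqP => [->|_]; first by rewrite scale1r.
  rewrite scale0r; split=> [//|j|j|j _|i]; rewrite ?mul0r ?mxE //.
    by case: (ks_d K j) => // u; rewrite mul0r.
  by rewrite big1 // => j _; rewrite mxE mulr0.
- by rewrite (bigD1 s) //= eqxx big1 ?addr0 // => s' /negPf ->.
- rewrite (bigD1 s) //= eqxx scale1r big1 ?addr0 // => s' /negPf ->.
  by rewrite scale0r.
Qed.

(** The bound on each cone is linear in its multiplier, so the bounds add up. *)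
Lemma knapsack_lp_value (R : realType) (k T n : nat) (K : knapsack k n)
    (c : 'rV[R]_n) (v : R) (x : 'cV[R]_n) :
  (forall j, 0 <= c 0 j) -> 0 <= v ->
  (forall x, ks_feasible K x -> (c *m int_vec R x) 0 0 <= v) ->
  elp_proj (knapsack_lp R T K) x -> 0 <= (c *m x) 0 0 /\
  (T%:R - 1) * (c *m x) 0 0 <= T%:R * v.
Proof.
move=> c0 v0 vP /knapsack_lpP[lam [z [zC lam1 ->]]].
rewrite mulmx_sumr summxE; split.
  apply: sumr_ge0 => s _; rewrite mxE; apply: sumr_ge0 => j _.
  have [l0 lb _ _ _] := zC s; rewrite mulr_ge0 //.
  by apply: le_trans (lb j); rewrite mulr_ge0.
rewrite mulr_sumr.
apply: (@le_trans _ _ (\sum_s T%:R * (lam s * v))).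
  by apply: ler_sum => s _; apply: guess_cone_value (zC s) c0 vP.
by rewrite -mulr_sumr -mulr_suml ler_wpM2l // ler_piMl.
Qed.

Lemma knapsack_lp_gap (R : realType) (k T n : nat) (eps : R) (K : knapsack k n)
    (c : 'rV[R]_n) :
  0 < eps -> eps^-1 <= T%:R -> (forall j, 0 <= c 0 j) ->
  ((1 - eps)%:E * elp_opt (knapsack_lp R T K) c <= ks_opt K c)%E.
Proof.
move=> eps0 epsT c0.
have f0 : ks_feasible K 0.
  split=> [j|i]; first by rewrite mxE; case: (ks_d K j).
  by rewrite mulmx0 mxE.
have c00 : (c *m int_vec R 0) 0 0 = 0.
  by rewrite mxE big1 // => j _; rewrite !mxE mulr0.
have opt0 : (0 <= ks_opt K c)%E.
  by rewrite -[0%E]/(0%:E) -c00; apply: ereal_sup_ubound; exists 0.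
have lopt0 : (0 <= elp_opt (knapsack_lp R T K) c)%E.
  rewrite -[0%E]/(0%:E) -c00; apply: ereal_sup_ubound; exists (int_vec R 0) => //.
  exact/knapsack_lp_relaxation.
have vP x : ks_feasible K x -> (((c *m int_vec R x) 0 0)%:E <= ks_opt K c)%E.
  by move=> xf; apply: ereal_sup_ubound; exists x.
case E: (ks_opt K c) opt0 vP => [v| |] // v0 vP; last by rewrite leey.
(* For [eps >= 1] the left side is at most 0, while the zero packing makes [ks_opt] nonnegative. *)
have [e1|e1] := leP (1 - eps) 0.
  by apply: le_trans (mule_le0_ge0 _ lopt0) v0; rewrite lee_fin.
rewrite -lee_pdivlMl // -EFinM; apply: ge_ereal_sup => _ [x xL <-].
rewrite lee_fin ler_pdivlMl //.
have [||cx0 le] := @knapsack_lp_value R k T n K c v x c0 _ _ xL.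
- by rewrite -lee_fin.
- by move=> w /vP; rewrite lee_fin.
have T0 : 0 < T%:R :> R by apply: lt_le_trans epsT; rewrite invr_gt0.
(* This gives [T * (1 - eps) <= T - 1], which links the averaging bound to [eps]. *)
have Te : 1 <= T%:R * eps by rewrite -ler_pdivrMr // div1r.
rewrite -(ler_pM2l T0); nra.
Qed.

(** Each bound [ks_d K j], even an infinite one, is charged at least one digit. *)
Lemma input_size_ge (k n : nat) (K : knapsack k n) : (n <= input_size K)%N.
Proof.
apply: leq_trans (leq_addl _ _).
rewrite -[X in (X <= _)%N]card_ord -sum1_card; apply: leq_sum => j _.
by case: (ks_d K j).
Qed.

Theorem theorem2 (R : realType) (k : nat) (eps : R)
    (k_gt0 : (0 < k)%N) (eps_gt0 : 0 < eps) :
  exists p : {poly nat}, forall (n : nat) (K : knapsack k n),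
  exists L : ext_lp R n,
    [/\ (n + elp_extra L <= p.[input_size K])%N,
        (elp_rows L <= p.[input_size K])%N,
        extended_relaxation K L &
        forall c : 'rV[R]_n, (forall j, 0 <= c 0 j) ->
          ((1 - eps)%:E * elp_opt L c <= ks_opt K c)%E].
Proof.
(* [m] is the number of slots of a guess; it depends on [k] and [eps] only, so the [(n + 1) ^ m]
   guesses are polynomially many. *)
pose T := Num.bound eps^-1; pose m := (T * (k * k))%N.
have epsT : eps^-1 <= T%:R :> R.
  by apply/ltW/archi_boundP; rewrite invr_ge0 ltW.
(* This is the row count with [n] as the indeterminate: [3 * n + k + 1] rows per guess, [2 * n] for
   the equations defining [x], and one for the total multiplier. It also dominates the number of
   variables. *)
exists (('X + 1) ^+ m * ('X * 3%:P + k.+1%:P) + ('X * 2%:P + 1)) => n K.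
exists (knapsack_lp R T K).
have hN : (n <= input_size K)%N := input_size_ge K.
rewrite !(hornerD, hornerM, horner_exp, hornerX, hornerC) !ssralg.natrE.
have G : #|{: guess k T n}| = (n.+1 ^ m)%N.
  by rewrite card_ffun card_option !card_prod !card_ord.
have le : (n.+1 ^ m <= (input_size K + 1) ^ m)%N.
  by case: (posnP m) => [->|m0]; rewrite ?expn0 ?leq_exp2r ?addn1.
split.
- rewrite /= card_sum card_prod G card_ord; nia.
- rewrite /= !card_sum card_prod G !card_sum !card_ord card_unit; nia.
- exact: knapsack_lp_relaxation.
- by move=> c; apply: knapsack_lp_gap.
Qed.
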